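(* Let $\mathbb{F}$ be either $\mathbb{R}$ or $\mathbb{C}$, and let $N$ be a norm on an infinite-dimensional vector space $X$ over $\mathbb{F}$ such that $N$ is ubiquitously continuous with respect to two complete norms $N_1$ and $N_2$ on $X$. Then $N_1$ and $N_2$ are equivalent.
   Context: A norm $M$ on $X$ is called complete if $X$ is complete with respect to $M$ (every Cauchy sequence with respect to $M$ converges in $X$ with respect to $M$). A function $X\to\mathbb{R}$ is ubiquitously continuous with respect to a norm $M$ on $X$ if it is continuous at every point of $X$ in the topology on $X$ induced by $M$. Two norms $N_1$, $N_2$ on $X$ are equivalent if there exist positive constants $\beta\le\gamma$ such that $\beta N_1(x)\le N_2(x)\le\gamma N_1(x)$ for all $x\in X$. *)

(* Defs.v *)
From HB Require Import structures.
From mathcomp Require Import all_boot all_order all_algebra.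
From mathcomp Require Import complex.
From mathcomp Require Import boolp classical_sets reals topology normedtype.

Set Implicit Arguments.
Unset Strict Implicit.
Unset Printing Implicit Defensive.

Import Order.TTheory GRing.Theory Num.Theory.
Import numFieldNormedType.Exports.

Local Open Scope classical_set_scope.
Local Open Scope ring_scope.

Variant scalar_kind := RealScalars | ComplexScalars.

Definition scalars (R : realType) (F : scalar_kind) : numFieldType :=
  match F with
  | RealScalars => R
  | ComplexScalars => R[i]
  end.

(* On [R[i]] the norm [`|z|] is itself an element of [R[i]]; [Normc.normc] is
   the modulus as an element of [R]. *)
Definition modulus (R : realType) (F : scalar_kind) : scalars R F -> R :=
  match F with
  | RealScalars => fun a : R => `|a|
  | ComplexScalars => fun z : R[i] => Normc.normc z
  end.

(* Nonnegativity and [norm 0 = 0] follow from the axioms. *)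
Record norm (R : realType) (F : scalar_kind) (X : lmodType (scalars R F)) :=
  Norm {
    norm_fun :> X -> R;
    norm_triangle : forall x y, norm_fun (x + y) <= norm_fun x + norm_fun y;
    norm_scale : forall a x, norm_fun (a *: x) = modulus a * norm_fun x;
    norm_eq0 : forall x, norm_fun x = 0 -> x = 0
  }.

(* [X] carries several norms at once, hence an alias of [X] for each norm [M],
   to which the topology and uniformity induced by [M] are attached. *)
Definition normed_by (R : realType) (F : scalar_kind)
  (X : lmodType (scalars R F)) (M : norm X) : Type := X.

Section NormedBy.
Context (R : realType) (F : scalar_kind) (X : lmodType (scalars R F)).
Variable M : norm X.

Let modulus_nat n : modulus (n%:R : scalars R F) = n%:R.
Proof.
case: F => /=; first exact: normr_nat.
have -> : (n%:R : R[i]) = (n%:R : R)%:C%C by rewrite rmorph_nat.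
by rewrite /= expr0n /= addr0 sqrtr_sqr normr_nat.
Qed.

Let modulusN1 : modulus (-1 : scalars R F) = 1.
Proof.
by case: F => /=; rewrite ?normrN1 // oppr0 expr0n /= addr0 sqrrN expr1n sqrtr1.
Qed.

Let normMn (x : X) n : M (x *+ n) = M x *+ n.
Proof. by rewrite -scaler_nat norm_scale modulus_nat mulr_natl. Qed.

Let normN (x : X) : M (- x) = M x.
Proof. by rewrite -scaleN1r norm_scale modulusN1 mul1r. Qed.

HB.instance Definition _ := GRing.Zmodule.copy (normed_by M) X.

HB.instance Definition _ := Num.Zmodule_isNormed.Build R (normed_by M)
  (@norm_triangle _ _ _ M) (@norm_eq0 _ _ _ M) normMn normN.

HB.instance Definition _ :=
  PseudoMetric.copy (normed_by M) (pseudoMetric_normed (normed_by M)).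

HB.instance Definition _ := isPointed.Build (normed_by M) 0.

HB.instance Definition _ :=
  NormedZmod_PseudoMetric_eq.Build R (normed_by M) erefl.

End NormedBy.

Section Notions.
Context (R : realType) (F : scalar_kind) (X : lmodType (scalars R F)).

Definition complete_norm (M : norm X) : Prop :=
  forall u : nat -> normed_by M, cauchy (u @ \oo) -> cvg (u @ \oo).

Definition ubiquitously_continuous (M : norm X) (f : X -> R) : Prop :=
  continuous (f : normed_by M -> R).

Definition equivalent_norms (N1 N2 : norm X) : Prop :=
  exists beta gamma : R,
    [/\ 0 < beta, beta <= gamma &
        forall x : X, beta * N1 x <= N2 x <= gamma * N1 x].

End Notions.

(* [Vector.axiom n X] is the type of linear bijections from [X] to ['rV[K]_n]. *)
Definition infinite_dimensional (K : fieldType) (X : lmodType K) : Prop :=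
  forall n : nat, Vector.axiom n X -> False.

(* Main.v *)
Require Import Defs.
From mathcomp Require Import all_boot all_algebra reals.
From mathcomp Require Import all_order complex interval_inference.
From mathcomp Require Import boolp classical_sets topology normedtype.
From mathcomp Require Import sequences lra.

Set Implicit Arguments.
Unset Strict Implicit.
Unset Printing Implicit Defensive.

Import Order.TTheory GRing.Theory Num.Theory.
Import numFieldNormedType.Exports.

Local Open Scope classical_set_scope.
Local Open Scope ring_scope.

(** Continuity of [N] makes convergence in [N1] and in [N2] both imply
    convergence in the Hausdorff topology of [N], so a sequence that converges
    for both norms has the same limit for both: the identity from [(X, N1)] to
    [(X, N2)] has a closed graph. By the closed graph theorem it is bounded,
    and by symmetry so is its inverse; the two bounds are the equivalence.

    The case of the closed graph theorem that is needed is proved directly, in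
    the two classical halves of the open mapping argument, both resting on
    [complete_nested_balls]: in a complete norm, balls whose radii halve and
    whose centres move by at most half the radius have a common point.

    - Baire half, completeness of [N1] ([sphere_approx], [nearly_open]). The
      sublevel sets of [N2] cover [X], so some sublevel set is [N1]-dense near
      some point; otherwise nested balls avoiding the sublevel sets of levels
      1, 2, 3, ... would shrink to a point where [N2] is infinite. Hence, for
      some [K], every [x] is an [N1]-limit of points [y] with
      [N2 y <= K * N1 x].
    - Successive approximation, completeness of [N2]
      ([complete_norm_dominated]). Subtracting such approximations [y] over
      and over from [x] leaves remainders that tend to [0] in [N1] and form a
      geometric Cauchy sequence in [N2]. The two limits agree because of [N],
      so the remainders tend to [0] in [N2] as well, and summing the geometric
      series gives [N2 x <= 2 * K * N1 x]. *)

(** * Norms and dilations *)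

Section NormFacts.
Context (R : realType) (F : scalar_kind) (X : lmodType (scalars R F)).
Implicit Types (M : norm X) (x y : X).

Lemma norm_normE M x : `|x : normed_by M| = M x.
Proof. by []. Qed.

Lemma norm_ge0 M x : 0 <= M x.
Proof. exact: (@normr_ge0 R (normed_by M) x). Qed.

Lemma norm_opp M x : M (- x) = M x.
Proof. exact: (@normrN R (normed_by M) x). Qed.

Lemma norm_zero M : M 0 = 0.
Proof. exact: (@normr0 R (normed_by M)). Qed.

Lemma norm_distC M x y : M (x - y) = M (y - x).
Proof. by rewrite -norm_opp opprB. Qed.

Lemma norm_dist_triangle M x y z : M (x - z) <= M (x - y) + M (y - z).
Proof. by rewrite -{1}(subrKA y x (- z)) norm_triangle. Qed.

(** Dilations by a positive factor exist over both fields; they replace scalar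
    multiplication by a real number, which is not directly available when the
    scalars are complex. *)
Lemma modulus_surj (c : R) : 0 < c ->
  exists2 a : scalars R F, a != 0 & modulus a = c.
Proof.
clear X; case: F => /= c0; first by exists c; rewrite ?gt_eqF// gtr0_norm.
exists (c%:C)%C; first by rewrite fmorph_eq0 gt_eqF.
by rewrite /= expr0n /= addr0 sqrtr_sqr gtr0_norm.
Qed.

Lemma norm_scaleV M (a : scalars R F) (c : R) x :
  a != 0 -> 0 < c -> modulus a = c -> M (a^-1 *: x) = c^-1 * M x.
Proof.
move=> a0 c0 ac; rewrite -[in RHS](scalerKV a0 x) (norm_scale _ a) ac.
by rewrite mulrA mulVf ?mul1r// gt_eqF.
Qed.

End NormFacts.

(** * Completeness *)

Lemma halving_sequence_small (R : realType) (r : nat -> R) :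
  (forall n, 0 <= r n) -> (forall n, r n.+1 <= r n / 2) ->
  forall e, 0 < e -> exists n, r n < e.
Proof.
move=> r0 rS e e0.
have rle n : r n <= r 0%N * (1 / 2 ^+ n).
  elim: n => [|n ih]; first by rewrite expr0 divr1 mulr1.
  apply: le_trans (rS n) _.
  have -> : r 0%N * (1 / 2 ^+ n.+1) = (r 0%N * (1 / 2 ^+ n)) / 2.
    by rewrite exprS invfM !mul1r mulrCA mulrC.
  by rewrite ler_pM2r ?invr_gt0.
have d0 : 0 < e / (r 0%N + 1) by rewrite divr_gt0// ltr_wpDl.
have [n hn] : exists n, 1 / 2 ^+ n < e / (r 0%N + 1).
  move: d0 => /posnumP[d].
  by have [n _ /(_ n (leqnn n))] := near_infty_natSinv_expn_lt d; exists n.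
exists n; apply: le_lt_trans (rle n) _.
move: hn; rewrite ltr_pdivlMr ?ltr_wpDl// => hn.
apply: le_lt_trans hn; rewrite mulrC ler_wpM2l ?lerDl//.
Qed.

Section CompleteNorms.
Context (R : realType) (F : scalar_kind) (X : lmodType (scalars R F)).
Implicit Types (M : norm X) (x y : X).

Lemma continuous_norm_at0 M (f : norm X) : ubiquitously_continuous M f ->
  forall e, 0 < e -> exists2 d, 0 < d & forall x, M x < d -> f x < e.
Proof.
move=> /(_ 0) /cvgrPdist_lt cf e /cf /nbhs_ballP [d /= d0 hd].
exists d => // x xd; have := hd x.
rewrite norm_zero sub0r normrN ger0_norm ?norm_ge0//; apply.
by rewrite -ball_normE /= sub0r normrN norm_normE.
Qed.

(** The hypotheses say that the closed ball of centre [u n.+1] and radius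
    [r n.+1] lies in the one of centre [u n] and radius [r n]; the limit of the
    centres stays in all of them. *)
Lemma complete_nested_balls M (u : nat -> X) (r : nat -> R) :
  complete_norm M -> (forall n, 0 <= r n) -> (forall n, r n.+1 <= r n / 2) ->
  (forall n, M (u n.+1 - u n) <= r n / 2) ->
  exists z, forall n, M (z - u n) <= r n.
Proof.
move=> cM r0 rS uS.
have tail n m : M (u (n + m)%N - u n) <= r n - r (n + m)%N.
  (* The bound telescopes, since [r m / 2 <= r m - r m.+1]. *)
  elim: m => [|m ih]; first by rewrite addn0 !subrr norm_zero.
  rewrite addnS.
  have := norm_dist_triangle M (u (n + m).+1) (u (n + m)%N) (u n).
  have := uS (n + m)%N; have := rS (n + m)%N; lra.
have tail_le n m : (n <= m)%N -> M (u m - u n) <= r n.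
  by move=> /subnKC <-; apply: le_trans (tail _ _) _; rewrite gerBl.
have /cM : cauchy ((u : nat -> normed_by M) @ \oo).
  apply: cauchy_exP => e e0.
  have [n rn] := halving_sequence_small r0 rS e0.
  exists (u n), n => // m /= nm.
  rewrite -ball_normE /= norm_normE norm_distC.
  exact: le_lt_trans (tail_le _ _ nm) rn.
move=> /cvg_ex [z /cvgrPdist_lt uz]; exists z => n.
apply/ler_addgt0Pr => e /uz [m _ hm].
have mn : (m <= maxn m n)%N by rewrite leq_maxl.
have := hm _ mn; rewrite norm_normE => zm.
have := norm_dist_triangle M z (u (maxn m n)) (u n).
have := tail_le n (maxn m n) (leq_maxr _ _); lra.
Qed.

(** * The Baire half *)

(** One step of the nested balls. If both the ball at [p] and the ball at
    [p + g] met the sublevel set [N2 <= k], the difference of the two points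
    would lie in the sublevel set of level [2 * k] and within [e] of [g], which
    is excluded; so one of the two balls avoids it. *)
Lemma ball_avoiding_sublevel (N1 N2 : norm X) (k r : R) (g p : X) (e : R) :
  0 < r -> 0 < e -> N1 g = r / 2 ->
  (forall y, N2 y <= 2 * k -> e < N1 (g - y)) ->
  exists p' r', [/\ 0 < r', r' <= r / 2, N1 (p' - p) <= r / 2 &
                  forall y, N1 (y - p') <= r' -> k < N2 y].
Proof.
move=> r0 e0 gr far.
pose r' := Num.min (r / 2) (e / 2).
have r'0 : 0 < r' by rewrite lt_min !divr_gt0.
have r'r : r' <= r / 2 by rewrite ge_min lexx.
have r'e : r' <= e / 2 by rewrite ge_min lexx orbT.
have [avoid|] := pselect (forall y, N1 (y - p) <= r' -> k < N2 y).
  exists p, r'; split => //; rewrite subrr norm_zero divr_ge0 ?ltW//.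
move=> /existsNP [y0 /not_implyP [y0p /negP]]; rewrite -leNgt => y0k.
exists (p + g), r'; split => //; first by rewrite addrC addKr gr.
move=> y1 y1p; rewrite ltNge; apply/negP => y1k.
have /far : N2 (y1 - y0) <= 2 * k.
  by have := norm_triangle N2 y1 (- y0); rewrite norm_opp; lra.
have -> : g - (y1 - y0) = (y0 - p) - (y1 - (p + g)).
  by rewrite !opprB -(addrA p g) -[in RHS]addrA addKr addrCA.
have := norm_triangle N1 (y0 - p) (- (y1 - (p + g))).
rewrite norm_opp; lra.
Qed.

(** Otherwise, for every level and every radius, some vector of that norm is at
    positive distance from the sublevel set, and [ball_avoiding_sublevel] can
    be iterated with growing levels; a point common to all the balls has [N2]
    larger than every integer. *)
Lemma sphere_approx (N1 N2 : norm X) : complete_norm N1 ->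
  exists k r, [/\ 0 < k, 0 < r & forall g, N1 g = r ->
    forall e, 0 < e -> exists2 y, N2 y <= k & N1 (g - y) <= e].
Proof.
move=> c1; apply: contrapT => none.
have far k r : 0 < k -> 0 < r -> exists g e,
    [/\ N1 g = r, 0 < e & forall y, N2 y <= k -> e < N1 (g - y)].
  move=> k0 r0; apply: contrapT => nofar; apply: none.
  exists k, r; split => // g gr e e0; apply: contrapT => noy.
  apply: nofar; exists g, e; split => // y yk; rewrite ltNge.
  by apply/negP => ge; apply: noy; exists y.
have step (s : nat * (X * R)) : exists t : X * R, 0 < s.2.2 ->
    [/\ 0 < t.2, t.2 <= s.2.2 / 2, N1 (t.1 - s.2.1) <= s.2.2 / 2 &
        forall y, N1 (y - t.1) <= t.2 -> s.1.+1%:R < N2 y].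
  case: s => n [p r] /=; have [r0|] := boolP (0 < r); last by exists (0, 0).
  have k0 : 0 < 2 * n.+1%:R :> R by rewrite mulr_gt0.
  have r20 : 0 < r / 2 by rewrite divr_gt0.
  have [g [e [gr e0 ge]]] := far _ _ k0 r20.
  have [p' [r' ?]] := ball_avoiding_sublevel p r0 e0 gr ge.
  by exists (p', r').
have [f fP] := choice step.
pose s := fix s n : X * R := if n is m.+1 then f (m, s m) else (0, 1).
have s0 n : 0 < (s n).2 by elim: n => [//|n /(fP (n, s n)) []].
have [|n|n|z zs] := @complete_nested_balls N1 (fun n => (s n).1)
  (fun n => (s n).2) c1.
- by move=> n; exact: ltW.
- by have [] := fP (n, s n) (s0 n).
- by have [] := fP (n, s n) (s0 n).
have zbig n : n.+1%:R < N2 z.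
  by have [_ _ _] := fP (n, s n) (s0 n); apply; apply: zs n.+1.
have := zbig (Num.bound (N2 z)); apply/negP; rewrite -leNgt.
have := archi_boundP (norm_ge0 N2 z) => /ltW /le_trans; apply.
by rewrite ler_nat.
Qed.

(** Homogeneity turns [sphere_approx] into a bound on all of [X]. In terms of
    the identity from [(X, N2)] to [(X, N1)]: the closure of the image of a
    ball is a neighbourhood of [0], that is, the identity is nearly open. *)
Lemma nearly_open (N1 N2 : norm X) : complete_norm N1 ->
  exists2 K, 0 < K & forall x e, 0 < e ->
    exists2 y, N2 y <= K * N1 x & N1 (x - y) <= e.
Proof.
move=> /(@sphere_approx _ N2) [k [r [k0 r0 kr]]].
exists (k / r); first by rewrite divr_gt0.
move=> x e e0; have [x0|x0] := eqVneq (N1 x) 0.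
  exists 0; first by rewrite norm_zero x0 mulr0.
  by rewrite subr0 x0 ltW.
have x_gt0 : 0 < N1 x by rewrite lt_neqAle eq_sym x0 norm_ge0.
have c0 : 0 < r / N1 x by rewrite divr_gt0.
have [a a0 ac] := modulus_surj F c0.
have gr : N1 (a *: x) = r by rewrite norm_scale ac divfK.
have [y yk gy] := kr _ gr _ (mulr_gt0 c0 e0).
exists (a^-1 *: y).
  have -> : k / r * N1 x = (r / N1 x)^-1 * k.
    by rewrite invf_div mulrC mulrCA mulrC.
  by rewrite (norm_scaleV _ _ a0 c0 ac) ler_pM2l ?invr_gt0.
rewrite -{1}(scalerK a0 x) -scalerBr (norm_scaleV _ _ a0 c0 ac).
by rewrite ler_pdivrMl.
Qed.

(** * Successive approximation *)

(** The remainders [t n] satisfy [N1 (t n) <= N1 x / 2 ^+ n], while their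
    steps are bounded in [N2] by a geometric series of sum [2 * K * N1 x].
    They converge to [0] in [N1] and to some [z] in [N2], hence to both in
    [N]; so [z = 0], and the sum of the series bounds the [N2]-distance from
    [t 0 = x] to [z]. *)
Lemma complete_norm_dominated (N N1 N2 : norm X) :
  complete_norm N1 -> complete_norm N2 ->
  ubiquitously_continuous N1 N -> ubiquitously_continuous N2 N ->
  exists2 K, 0 < K & forall x, N2 x <= K * N1 x.
Proof.
move=> c1 c2 /continuous_norm_at0 NN1 /continuous_norm_at0 NN2.
have [K K0 KP] := nearly_open N2 c1.
exists (2 * K); first by rewrite mulr_gt0.
move=> x; have [->|x_neq0] := eqVneq x 0; first by rewrite !norm_zero mulr0.
have x0 : 0 < N1 x.
  rewrite lt_neqAle norm_ge0 andbT eq_sym.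
  by apply: contra_neq x_neq0 => /norm_eq0.
pose d n : R := N1 x / 2 ^+ n.
have d0 n : 0 < d n by rewrite divr_gt0 ?exprn_gt0.
have dS n : d n.+1 = d n / 2 by rewrite /d exprSr invfM mulrA.
have step (s : nat * X) :
    exists y, N2 y <= K * N1 s.2 /\ N1 (s.2 - y) <= d s.1.+1.
  by have [y ? ?] := KP s.2 _ (d0 s.1.+1); exists y.
have [f fP] := choice step.
pose t := fix t n : X := if n is m.+1 then t m - f (m, t m) else x.
have td n : N1 (t n) <= d n.
  case: n => [|n]; first by rewrite /d expr0 divr1.
  by have [] := fP (n, t n).
have [n|n|n|z zt] :=
  @complete_nested_balls N2 t (fun n => 2 * K * d n) c2.
- by rewrite !mulr_ge0 ?ltW.
- by rewrite dS mulrA.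
- rewrite /= addrC addKr norm_opp.
  have [/= le1 _] := fP (n, t n); apply: le_trans le1 _.
  have := ler_wpM2l (ltW K0) (td n); lra.
suff z0 : z = 0.
  (* The ball of index 0, centred at [x], contains [z = 0]. *)
  have := zt 0%N; rewrite z0 sub0r norm_opp /= /d expr0 divr1; exact.
apply: (norm_eq0 (n := N)); apply/eqP; rewrite eq_le norm_ge0 andbT.
apply/ler_addgt0Pr => e e0; rewrite add0r.
have e20 : 0 < e / 2 by rewrite divr_gt0.
have [d1 d10 h1] := NN1 _ e20; have [d2 d20 h2] := NN2 _ e20.
have d30 : 0 < Num.min d1 (d2 / (2 * K)).
  by rewrite lt_min d10 divr_gt0// mulr_gt0.
have [n] := halving_sequence_small (fun n => ltW (d0 n))
  (fun n => eq_ind_r (fun v => v <= d n / 2) (lexx _) (dS n)) d30.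
rewrite lt_min ltr_pdivlMr ?mulr_gt0// => /andP[nd1 nd2].
have N1t := h1 _ (le_lt_trans (td n) nd1).
have /h2 N2t : N2 (z - t n) < d2.
  by apply: le_lt_trans (zt n) _; rewrite mulrC.
by have := norm_triangle N (z - t n) (t n); rewrite subrK; lra.
Qed.

End CompleteNorms.

Theorem theorem6 (R : realType) (F : scalar_kind) (X : lmodType (scalars R F))
  (N N1 N2 : norm X) :
  infinite_dimensional X ->
  complete_norm N1 ->
  complete_norm N2 ->
  ubiquitously_continuous N1 N ->
  ubiquitously_continuous N2 N ->
  equivalent_norms N1 N2.
Proof.
move=> _ c1 c2 NN1 NN2.
have [G G0 N2G] := complete_norm_dominated c1 c2 NN1 NN2.
have [B B0 N1B] := complete_norm_dominated c2 c1 NN2 NN1.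
exists B^-1, (Num.max G B^-1); split; first by rewrite invr_gt0.
  by rewrite le_max lexx orbT.
move=> x; rewrite ler_pdivrMl// N1B /=; apply: le_trans (N2G x) _.
by rewrite ler_wpM2r ?norm_ge0// le_max lexx.
Qed.
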